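(* Let $n\ge 1$, $t\ge 0$, $\ell\ge 1$ be integers with $n\ge 3t+1$. The protocol COOL described in the context solves Byzantine agreement on $\ell$-bit messages error-free: in every execution, against every adversary (of unbounded computational power, with no cryptographic assumptions whatsoever) controlling at most $t$ processors, it satisfies termination, consistency and validity. Moreover, COOL uses $O(t)$ rounds and a total of $O(\max\{n\ell,\ nt\log t\})$ communicated bits. (Thus it has resilience $n\ge 3t+1$, round complexity $O(t)$, and communication complexity $O(n\ell)$ whenever $\ell\ge t\log t$.)
   Context: Setting. There are $n$ processors indexed by $[1:n]=\{1,\dots,n\}$; every two are joined by a reliable private channel, communication is synchronous (in rounds), and each recipient knows the sender of every message. At most $t$ processors are dishonest; they are controlled by a Byzantine adversary of unbounded computational power that knows all inputs and may make them deviate arbitrarily (e.g. send different values to different processors, or send nothing; missing values are replaced by a fixed default). The others are honest. Processor $i$ holds an $\ell$-bit initial message $\boldsymbol w_i$. $\phi$ denotes a default value different from every $\ell$-bit message. Logarithms are base 2. Byzantine agreement requirements: termination (every honest processor eventually outputs a message and terminates), consistency (all honest processors output the same message), validity (if all honest processors have the same initial message, they all output it). A protocol is error-free if these hold in every execution. Code. Let $k=\lfloor t/5\rfloor+1$ and $c=\lceil \max\{\ell,(t/5+1)\log(n+1)\}/k\rceil$ (so $n\le 2^c-1$). Every $\ell$-bit message is padded with zeros to $kc$ bits and regarded as a vector in $GF(2^c)^k$. Integers in $[1:n]$ are identified with distinct nonzero elements of $GF(2^c)$ (e.g. via binary representation), and for $i\in[1:n]$ the vector $\boldsymbol h_i\in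 GF(2^c)^k$ has entries $h_{i,j}=\prod_{p\in[1:k],\,p\ne j}\frac{i-p}{j-p}$, $j\in[1:k]$, computed in $GF(2^c)$; so $\boldsymbol h_i^{\mathsf T}\boldsymbol x$ is the value at $i$ of the polynomial of degree $<k$ taking values $x_1,\dots,x_k$ at $1,\dots,k$. Core protocol (run by all $n$ processors; steps of honest processor $i$). Initialization: $\boldsymbol w^{(i)}:=\boldsymbol w_i$ (the ''updated message''), $y^{(i)}_j:=\boldsymbol h_j^{\mathsf T}\boldsymbol w_i$ for $j\in[1:n]$, $u_i(i):=1$. Phase 1. (a) Send the pair $(y^{(i)}_j,y^{(i)}_i)$ to each $j\neq i$. (b) For $j\ne i$, set the link indicator $u_i(j):=1$ if the pair received from $j$ equals $(y^{(i)}_i,y^{(i)}_j)$, else $u_i(j):=0$. Set the success indicator $s_i:=1$ if $\sum_{j=1}^n u_i(j)\ge n-t$; otherwise $s_i:=0$ and $\boldsymbol w^{(i)}:=\phi$. (c) Send $s_i$ to all processors; each processor records for every $j$ the indicator received from $j$ (its own for itself) and forms $\mathcal S_1=\{j: s_j=1\}$, $\mathcal S_0=\{j: s_j=0\}$ (views may differ between processors). Phase 2. If $s_i=1$: set $u_i(j):=0$ for all $j\in\mathcal S_0$; if now $\sum_j u_i(j)<n-t$, set $s_i:=0$, $\boldsymbol w^{(i)}:=\phi$ and send $s_i=0$ to all. Every processor overwrites its recorded indicators with newly received ones and recomputes $\mathcal S_0,\mathcal S_1$. Phase 3. Repeat the steps of Phase 2 once more. Then set the vote $v_i:=1$ if the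 recorded indicators satisfy $\sum_{j=1}^n s_j\ge 2t+1$, else $v_i:=0$. All processors run on the votes a deterministic error-free binary Byzantine agreement protocol for $t<n/3$ using $O(nt)$ bits and $O(t)$ rounds (e.g. Berman–Garay–Perry or Coan–Welch), guaranteeing that all honest processors decide, decide equally, and decide the common honest vote if all honest votes agree. If the decision is $0$, processor $i$ sets $\boldsymbol w^{(i)}:=\phi$, outputs $\phi$ and stops. Phase 4 (decision $1$). If $s_i=0$: replace $y^{(i)}_i$ by the most frequent value (fixed tie-breaking) among the first components of the Phase-1 pairs received from processors $j\in\mathcal S_1$; send the new $y^{(i)}_i$ to every $j\in\mathcal S_0\setminus\{i\}$; form $z_1,\dots,z_n$ with $z_i=y^{(i)}_i$, $z_j$ = value received from $j$ in Phase 4 for $j\in\mathcal S_0\setminus\{i\}$, and $z_j$ = second component of the Phase-1 pair from $j$ for $j\in\mathcal S_1$; set $\boldsymbol w^{(i)}$ to a message $\boldsymbol x$ with $\boldsymbol h_j^{\mathsf T}\boldsymbol x=z_j$ for at least $n-t$ indices $j$ (Reed–Solomon decoding correcting up to $t$ errors; $\phi$ if none exists). If $s_i=1$, keep $\boldsymbol w^{(i)}$. Output $\boldsymbol w^{(i)}$ and stop. COOL in general. If $t=\Omega(n)$ (i.e. $n\le Ct$ for a fixed constant $C$), COOL is the core protocol. Otherwise, the processors of $Q=[1:n']$, $n'=3t+1$, run the core protocol among themselves (with $n$ replaced by $n'$ everywhere, in particular in $c$); then each $i\in Q$ sends to every processor outside $Q$ the value $\boldsymbol h_i^{\mathsf T}\boldsymbol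 w^{(i)}$ of its output (a fixed marker if the output is $\phi$), and each processor outside $Q$ outputs the message consistent with the values received from at least $n'-t$ processors of $Q$ (or $\phi$ if at least $n'-t$ markers are received). *)

(* Defs.v *)
From HB Require Import structures.
From mathcomp Require Import all_boot all_order all_algebra all_field.
Set Implicit Arguments. Unset Strict Implicit. Unset Printing Implicit Defensive.
Import GRing.Theory.

(* Messages are bit strings; [None] = nothing sent.  A vector of messages
   received in one round, indexed by the (known) sender. *)
Definition msgvec (n : nat) := 'I_n -> option bitseq.

(* A deterministic protocol in full-information form: what processor [i]
   with input [x] sends to [j] after having received the history [h]
   (one msgvec per elapsed round), and its output ([Some o] = it has output
   [o] and stops). *)
Record protocol (n : nat) (In Out : Type) := Protocol {
  p_send : 'I_n -> In -> seq (msgvec n) -> 'I_n -> option bitseq;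
  p_out  : 'I_n -> In -> seq (msgvec n) -> option Out }.

Definition hmsg n In Out (P : protocol n In Out) (i : 'I_n) (x : In)
    (h : seq (msgvec n)) (j : 'I_n) : option bitseq :=
  if p_out P i x h is Some _ then None else p_send P i x h j.

(* An (all-knowing, computationally unbounded) Byzantine adversary fixes what
   every dishonest sender sends to every receiver in every round.  Since the
   protocol is deterministic and the adversary knows all inputs, this covers
   all adaptive strategies. *)
Definition adversary (n : nat) := nat -> 'I_n -> 'I_n -> option bitseq.

Fixpoint hist n In Out (P : protocol n In Out) (H : {set 'I_n})
    (inp : 'I_n -> In) (adv : adversary n) (r : nat) : 'I_n -> seq (msgvec n) :=
  match r with
  | 0 => fun _ => [::]
  | r'.+1 => fun i => rcons (hist P H inp adv r' i)
      (fun j => if j \in H then hmsg P j (inp j) (hist P H inp adv r' j) i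
                else adv r' j i)
  end.

Definition terminates_at n In Out (P : protocol n In Out) (H : {set 'I_n})
    (inp : 'I_n -> In) (adv : adversary n) (i : 'I_n) (r : nat) (o : Out) : Prop :=
  p_out P i (inp i) (hist P H inp adv r i) = Some o /\
  forall r', (r' < r)%N -> p_out P i (inp i) (hist P H inp adv r' i) = None.

Definition msize (m : option bitseq) : nat := if m is Some s then size s else 0.

Definition bits_sent n In Out (P : protocol n In Out) (H : {set 'I_n})
    (inp : 'I_n -> In) (adv : adversary n) (R : nat) : nat :=
  \sum_(r < R) \sum_(i in H) \sum_(j : 'I_n | j != i)
     msize (hmsg P i (inp i) (hist P H inp adv r i) j).

Definition binary_BA_spec (ba : forall n t : nat, protocol n bool bool)
    (Rba : nat -> nat -> nat) : Prop :=
  exists K : nat, forall n t : nat, (3 * t < n)%N ->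
    (Rba n t <= K * t.+1)%N /\
    forall (H : {set 'I_n}) (inp : 'I_n -> bool) (adv : adversary n),
      (#|~: H| <= t)%N ->
      [/\ forall i, i \in H -> exists r o, (r <= Rba n t)%N /\
                                  terminates_at (ba n t) H inp adv i r o,
          forall i j r1 r2 o1 o2, i \in H -> j \in H ->
            terminates_at (ba n t) H inp adv i r1 o1 ->
            terminates_at (ba n t) H inp adv j r2 o2 -> o1 = o2,
          forall b, (forall i, i \in H -> inp i = b) ->
            forall i r o, i \in H -> terminates_at (ba n t) H inp adv i r o -> o = b
        & (bits_sent (ba n t) H inp adv (Rba n t) <= K * (n * t.+1))%N ].

Definition first_out (M O : Type) (f : seq M -> option O) (s : seq M) : option O :=
  head None (filter (@isSome O) [seq f (take r s) | r <- iota 0 (size s).+1]).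

Lemma maxn1_gt0 c : (0 < maxn c 1)%N. Proof. by rewrite leq_max orbT. Qed.

Definition GF (c : nat) : finFieldType :=
  s2val (@pPrimePowerField 2 (maxn c 1) isT (maxn1_gt0 c)).

Section Field.
Variable c : nat.
Local Notation F := (GF c).

Definition rank0 : nat := enum_rank (0 : F)%R.
(* bijection F <-> [0, |F|) sending 0 to 0 *)
Definition code (x : F) : nat :=
  if x == 0%R then 0 else if (enum_rank x : nat) == 0 then rank0 else enum_rank x.
(* integers are identified with field elements via [elt]; 0 |-> 0, and
   1..|F|-1 go to distinct nonzero elements *)
Definition elt (m : nat) : F :=
  nth 0%R (enum F) (if m == 0 then rank0 else if m == rank0 then 0 else m).
Definition bits_of (x : F) : bitseq := mkseq (fun b => odd (code x %/ 2 ^ b)) c.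
Definition nat_of_bits (s : bitseq) : nat := foldr (fun (b : bool) (a : nat) => (b : nat) + a.*2) 0 s.
Definition of_bits (s : bitseq) : F := elt (nat_of_bits s).
Definition recvF (o : option bitseq) : F :=
  if o is Some s then (if size s == c then of_bits s else 0%R) else 0%R.
Definition mode (s : seq F) : F := [arg max_(y > (0 : F)%R) count_mem y s].
End Field.

Definition kpar (t : nat) : nat := t %/ 5 + 1.

(* c = ceil(max(l, (t/5+1) log2(n+1)) / k): the least c with c*k >= l and
   c*k >= (t/5+1) log2(n+1), i.e. 2^(5ck) >= (n+1)^(t+5). *)
Definition cpar (n t l : nat) : nat :=
  find (fun c => (l <= c * kpar t) && ((n.+1) ^ (t + 5) <= 2 ^ (5 * (c * kpar t))))
       (iota 0 (l + (t + 5) * n.+1).+1).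

Section Code.
Variables (n0 t l : nat).
Local Notation k := (kpar t).
Local Notation c := (cpar n0 t l).
Local Notation F := (GF c).

Definition pad (m : l.-tuple bool) : bitseq := m ++ nseq (k * c - l) false.
Definition vecm (m : l.-tuple bool) (j : nat) : F :=
  of_bits c (take c (drop (j * c) (pad m))).
(* h_{i,j+1}: Lagrange coefficients (i an integer, j 0-based) *)
Definition hcoef (i j : nat) : F :=
  (\prod_(p < k | (p : nat) != j)
     ((elt c i - elt c p.+1) / (elt c j.+1 - elt c p.+1)))%R.
Definition evalm (i : nat) (m : l.-tuple bool) : F :=
  (\sum_(j < k) hcoef i j * vecm m j)%R.
End Code.

Section COOL.
Variables (ba : forall n t : nat, protocol n bool bool) (Rba : nat -> nat -> nat).
Variables (C n t l : nat).

(* core protocol run by all processors (t = Omega(n): n <= C t) or only by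
   Q = [1:3t+1] (ordinals 0 .. 3t) *)
Definition smallQ : bool := ~~ (n <= C * t)%N.
Definition n0 : nat := if smallQ then 3 * t + 1 else n.
Local Notation c := (cpar n0 t l).
Local Notation F := (GF c).
Local Notation R := (Rba n0 t).
Local Notation Msg := (l.-tuple bool).

Definition rv (h : seq (msgvec n)) (r : nat) (j : 'I_n) : option bitseq :=
  nth (fun _ => None) h r j.
Definition cnt (P : pred 'I_n) : nat := #|[set j : 'I_n | (j < n0)%N && P j]|.

(* processor with ordinal i has integer identity i+1 *)
Definition y0 (m : Msg) (j : 'I_n) : F := evalm n0 t j.+1 m.

Definition pairF (o : option bitseq) : F * F :=
  if o is Some s then
    if size s == (c + c)%N then (of_bits c (take c s), of_bits c (drop c s))
    else (0%R, 0%R)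
  else (0%R, 0%R).
Definition p1 (h : seq (msgvec n)) (j : 'I_n) : F * F := pairF (rv h 0 j).

Definition indic (o : option bitseq) (d : bool) : bool :=
  if o is Some [:: b] then b else d.

Section Proc.
Variables (i : 'I_n) (m : Msg) (h : seq (msgvec n)).

Definition u1 (j : 'I_n) : bool := (j == i) || (p1 h j == (y0 m i, y0 m j)).
Definition s1 : bool := (n0 - t <= cnt u1)%N.
Definition ind1 (j : 'I_n) : bool := if j == i then s1 else indic (rv h 1 j) false.
Definition u2 (j : 'I_n) : bool := u1 j && (s1 ==> ind1 j).
Definition s2 : bool := s1 && (n0 - t <= cnt u2)%N.
Definition ind2 (j : 'I_n) : bool := if j == i then s2 else indic (rv h 2 j) (ind1 j).
Definition u3 (j : 'I_n) : bool := u2 j && (s2 ==> ind2 j).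
Definition s3 : bool := s2 && (n0 - t <= cnt u3)%N.
Definition ind3 (j : 'I_n) : bool := if j == i then s3 else indic (rv h 3 j) (ind2 j).
Definition vote : bool := (2 * t + 1 <= cnt ind3)%N.

Definition restr (v : msgvec n) : msgvec n0 :=
  fun j : 'I_n0 => if (insub (j : nat) : option 'I_n) is Some j' then v j' else None.
Definition bahist : seq (msgvec n0) := map restr (drop 4 h).
Definition bamsg (j : 'I_n) : option bitseq :=
  match (insub (i : nat) : option 'I_n0),
        (insub (j : nat) : option 'I_n0) with
  | Some bi, Some bj => hmsg (ba n0 t) bi vote bahist bj
  | _, _ => None
  end.
Definition dec : bool :=
  if (insub (i : nat) : option 'I_n0) is Some bi then
    odflt false (first_out (p_out (ba n0 t) bi vote) (take R bahist))
  else false.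

Definition ynew : F :=
  mode [seq (p1 h j).1 | j : 'I_n <- enum 'I_n & (j < n0)%N && ind3 j].
Definition zval (j : 'I_n) : F :=
  if j == i then ynew else if ind3 j then (p1 h j).2 else recvF c (rv h (4 + R) j).
Definition decode : option Msg :=
  [pick w : Msg | (n0 - t <= cnt (fun j : 'I_n => evalm n0 t j.+1 w == zval j))%N].
(* output of the core protocol (None = phi) *)
Definition core_result : option Msg :=
  if ~~ dec then None else if s3 then Some m else decode.

Definition core_send (j : 'I_n) : option bitseq :=
  if ~~ ((i < n0)%N && (j < n0)%N) then None else
  let r := size h in
  if r == 0 then (if j == i then None else Some (bits_of (y0 m j) ++ bits_of (y0 m i)))
  else if r == 1 then (if j == i then None else Some [:: s1])
  else if r == 2 then (if (j != i) && s1 && ~~ s2 then Some [:: false] else None)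
  else if r == 3 then (if (j != i) && s2 && ~~ s3 then Some [:: false] else None)
  else if (r < 4 + R)%N then bamsg j
  else if r == 4 + R then
    (if dec && ~~ s3 && (j != i) && ~~ ind3 j then Some (bits_of ynew) else None)
  else None.

Definition q_send (j : 'I_n) : option bitseq :=
  if (i < n0)%N && ~~ (j < n0)%N && (size h == 5 + R) then
    Some (if core_result is Some w then true :: bits_of (evalm n0 t i.+1 w)
          else [:: false])
  else None.

Definition outsider_result : option Msg :=
  let v := fun j : 'I_n => rv h (5 + R) j in
  if (n0 - t <= cnt (fun j : 'I_n => v j == Some [:: false]))%N then None
  else [pick w : Msg | (n0 - t <= cnt (fun j : 'I_n =>
                           v j == Some (true :: bits_of (evalm n0 t j.+1 w))))%N].

Definition cool_send (j : 'I_n) : option bitseq :=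
  if smallQ && (size h == 5 + R) then q_send j else core_send j.

Definition cool_out : option (option Msg) :=
  if ~~ smallQ then
    (if (size h < 4 + R)%N then None
     else if ~~ dec then Some None
     else if (size h < 5 + R)%N then None
     else Some core_result)
  else if (size h < 6 + R)%N then None
  else if (i < n0)%N then Some core_result
  else Some outsider_result.
End Proc.

Definition COOL : protocol n (l.-tuple bool) (option (l.-tuple bool)) :=
  Protocol (fun i m h j => cool_send i m h j) (fun i m h => cool_out i m h).
End COOL.

(* Main.v *)
(** Let [y_q] be the symbol of processor [q] on its own polynomial.  Every
    honest processor that passes Phase 1 has a polynomial agreeing with the word
    [(y_q)_q] on all but [t] of the at least [2t+1] honest positions, whereas
    distinct polynomials agree on at most [t/5] positions; three such polynomials
    do not fit, so at most two messages survive Phase 1.  If both survived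
    Phase 3, each would have, after Phase 2, a holder outside the small agreement
    set of the two polynomials, hence linked only to Phase-1 survivors with its
    own message; the two groups of such survivors would then overfill the honest
    set.  So a single message [w] survives Phase 3.  Decision 1 forces [t+1]
    honest survivors; majority and unique decoding then give [w] everywhere. *)
Require Import Defs.
From HB Require Import structures.
From mathcomp Require Import all_boot all_order all_algebra all_field.
From mathcomp Require Import zify ring.
From Stdlib Require Import FunctionalExtensionality.
Set Implicit Arguments. Unset Strict Implicit. Unset Printing Implicit Defensive.
Import GRing.Theory.
Local Open Scope nat_scope.

(** * Symbols as bit strings *)

Lemma card_GF c : 0 < c -> #|GF c| = 2 ^ c.
Proof.
move=> c0; rewrite /GF.
by case: pPrimePowerField => F /= _ ->; congr (2 ^ _); apply/maxn_idPl.
Qed.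

Lemma rank0_lt c : rank0 c < #|GF c|.
Proof. exact: ltn_ord. Qed.

Lemma nth_rank0 c : nth 0%R (enum (GF c)) (rank0 c) = 0%R.
Proof. exact: (nth_enum_rank 0%R). Qed.

(** [code] and [elt] both apply the transposition that swaps [0] with the rank of the zero element,
    so one undoes the other. *)
Lemma elt_code c (x : GF c) : elt c (code x) = x.
Proof.
have nthE (y : GF c) : nth 0%R (enum (GF c)) (enum_rank y) = y.
  exact: nth_enum_rank.
have r0 (y : GF c) : y != 0%R -> (enum_rank y : nat) != rank0 c.
  by apply: contra => /eqP/ord_inj/enum_rank_inj ->.
rewrite /elt /code; have [->|x0] := eqVneq x 0%R; first by rewrite eqxx nth_rank0.
have [xr|xr] := eqVneq (enum_rank x : nat) 0.
  by have := r0 x x0; rewrite xr eq_sym => /negPf->; rewrite eqxx -{1}xr nthE.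
by rewrite (negPf xr) (negPf (r0 x x0)) nthE.
Qed.

Lemma code_lt c (x : GF c) : code x < #|GF c|.
Proof.
rewrite /code; case: ifP => _; first by apply/card_gt0P; exists 0%R.
by case: ifP => _; [exact: rank0_lt | exact: ltn_ord].
Qed.

Lemma elt_inj c : 0 < c -> {in [pred m | m < 2 ^ c] &, injective (elt c)}.
Proof.
move=> c0 a b; rewrite !inE -(card_GF c0) => ha hb.
have nthinj p q : p < #|GF c| -> q < #|GF c| ->
    nth 0%R (enum (GF c)) p = nth 0%R (enum (GF c)) q -> p = q.
  by rewrite cardE => hp hq /eqP; rewrite nth_uniq ?enum_uniq // => /eqP.
have := rank0_lt c; rewrite /elt => hr.
have h0 : 0 < #|GF c| by apply: leq_ltn_trans hr.
case: (eqVneq a 0) => [->|a0]; case: (eqVneq b 0) => [->|b0] //.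
- case: (eqVneq b (rank0 c)) => [br|br] /nthinj e; last by rewrite -e ?eqxx in br.
  by rewrite br -e ?eqxx in b0.
- case: (eqVneq a (rank0 c)) => [ar|ar] /nthinj e; last by rewrite e ?eqxx in ar.
  by rewrite ar e ?eqxx in a0.
case: (eqVneq a (rank0 c)) => [ar|ar]; case: (eqVneq b (rank0 c)) => [br|br].
- by rewrite ar br.
- by move/nthinj => e; move: b0; rewrite -e // eqxx.
- by move/nthinj => e; move: a0; rewrite e // eqxx.
- by move/nthinj => e; apply: e.
Qed.

Lemma nat_of_bits_lt s : nat_of_bits s < 2 ^ size s.
Proof. by elim: s => //= b s IH; rewrite expnS; case: b; lia. Qed.

Lemma nat_of_bits_inj s s' :
  size s = size s' -> nat_of_bits s = nat_of_bits s' -> s = s'.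
Proof.
elim: s s' => [|b s IH] [|b' s'] //= [sz] e.
have bb : b = b'.
  by have := congr1 odd e; rewrite !oddD !odd_double !addbF; case: (b) (b') => [] [].
by rewrite bb (IH s') //; move: e; rewrite bb; lia.
Qed.

Lemma nat_of_bits_mkseq c a :
  a < 2 ^ c -> nat_of_bits (mkseq (fun b => odd (a %/ 2 ^ b)) c) = a.
Proof.
elim: c a => [|c IH] a; first by rewrite expn0 ltnS leqn0 => /eqP->.
rewrite expnS => ha; rewrite /mkseq /= -(add1n 0) iotaDl -map_comp expn0 divn1.
rewrite (eq_map (g := fun b => odd (a./2 %/ 2 ^ b))); last first.
  by move=> b /=; rewrite add1n expnS divnMA divn2.
by rewrite -/(mkseq _ _) -/(nat_of_bits _) IH ?odd_double_half //; lia.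
Qed.

Lemma size_bits_of c (x : GF c) : size (bits_of x) = c.
Proof. exact: size_mkseq. Qed.

Lemma bits_ofK c : 0 < c -> cancel (@bits_of c) (of_bits c).
Proof.
by move=> c0 x; rewrite /of_bits nat_of_bits_mkseq ?elt_code // -card_GF // code_lt.
Qed.

Lemma of_bits_inj c s s' : 0 < c -> size s = c -> size s' = c ->
  of_bits c s = of_bits c s' -> s = s'.
Proof.
move=> c0 sz sz' e; apply: nat_of_bits_inj; first by rewrite sz.
by apply: (elt_inj c0) e; rewrite inE -[in 2 ^ _]sz ?nat_of_bits_lt // sz -sz' nat_of_bits_lt.
Qed.

(** Occurrences of distinct values are disjoint, so nothing is as frequent as a value that fills
    more than half of the list. *)
Lemma mode_majority c (s : seq (GF c)) m :
  size s < (count_mem m s).*2 -> mode s = m.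
Proof.
move=> maj; rewrite /mode; case: arg_maxnP => //= y _ /(_ m isT) ymax.
apply: contraTeq maj => ym; rewrite -leqNgt.
have : count_mem y s + count_mem m s <= size s.
  rewrite -count_predUI [X in _ + X](eq_count (a2 := pred0)) ?count_pred0 ?addn0.
    exact: count_size.
  by move=> z /=; apply/negbTE; apply: contraNN ym => /andP[/eqP<- /eqP<-].
by move=> le; apply: leq_trans le; rewrite -addnn leq_add2r.
Qed.

(** * The symbol length *)

Lemma kpar_gt0 t : 0 < kpar t. Proof. by rewrite /kpar addn1. Qed.

Definition cpar_ok (n t l c : nat) : bool :=
  (l <= c * kpar t) && ((n.+1) ^ (t + 5) <= 2 ^ (5 * (c * kpar t))).

Lemma cparP n t l : cpar_ok n t l (cpar n t l).
Proof.
rewrite /cpar -/(cpar_ok n t l).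
set s := iota _ _; have hs : has (cpar_ok n t l) s.
  (* The last candidate of the search range passes both tests, because [n.+1 <= 2 ^ n.+1] and
     [kpar t >= 1]. *)
  apply/hasP; exists (l + (t + 5) * n.+1); first by rewrite mem_iota; lia.
  have := kpar_gt0 t; rewrite /cpar_ok; set k := kpar t => k0.
  apply/andP; split; first nia.
  apply: leq_trans (_ : 2 ^ (n.+1 * (t + 5)) <= _).
    by rewrite expnM leq_exp2r ?addn_gt0 ?orbT //; apply/ltnW/ltn_expl.
  by rewrite leq_exp2l //; nia.
have := nth_find 0 hs; rewrite nth_iota ?add0n //.
by rewrite -[X in _ < X](size_iota 0) -has_find.
Qed.

Lemma cpar_min n t l c : c < cpar n t l -> ~~ cpar_ok n t l c.
Proof.
move=> lt; have := before_find 0 lt; rewrite nth_iota ?add0n => [/negbT//|].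
by apply: leq_trans lt _; rewrite -[X in _ <= X](size_iota 0) find_size.
Qed.

Lemma cpar_gt0 n t l : 0 < l -> 0 < cpar n t l.
Proof. by case/andP: (cparP n t l); case: (cpar n t l) => // + _; lia. Qed.

(** Since [5 * kpar t <= t + 5], the second test on [c] gives [n.+1 <= 2 ^ c] after taking roots of
    order [t + 5]. The field then has room for [0] and all identities up to [n]. *)
Lemma cpar_field n t l : n < 2 ^ cpar n t l.
Proof.
case/andP: (cparP n t l) => _ h.
have: n.+1 ^ (t + 5) <= (2 ^ cpar n t l) ^ (t + 5).
  by apply: leq_trans h _; rewrite -expnM leq_exp2l // mulnCA leq_mul2l /kpar; lia.
by rewrite leq_exp2r ?addn_gt0 ?orbT.
Qed.

(** * The Reed-Solomon code *)

Section Code.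
Variables (n t l : nat).
Hypothesis l0 : 0 < l.
Hypothesis kn : kpar t <= n.
Local Notation k := (kpar t).
Local Notation c := (cpar n t l).
Local Notation F := (GF c).
Let c0 : 0 < c. Proof. exact: cpar_gt0. Qed.

(** The padded string has exactly [k * c] bits, and bit [q] sits at offset [q %% c] of block
    [q %/ c]; equal symbols mean equal blocks. *)
Lemma vecm_inj (w w' : l.-tuple bool) :
  (forall j, j < k -> vecm n t w j = vecm n t w' j) -> w = w'.
Proof.
move=> e; apply: val_inj => /=.
have lk : l <= c * k by case/andP: (cparP n t l).
have szp (m : l.-tuple bool) : size (pad n t m) = k * c.
  by rewrite size_cat size_nseq size_tuple mulnC subnKC.
suff: pad n t w = pad n t w'.
  by move/(congr1 (take l)); rewrite /pad !take_size_cat ?size_tuple.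
have eb j : j < k -> take c (drop (j * c) (pad n t w)) = take c (drop (j * c) (pad n t w')).
  move=> jk; apply: (of_bits_inj c0); last exact: e.
    by rewrite size_takel // size_drop szp; nia.
  by rewrite size_takel // size_drop szp; nia.
apply: (@eq_from_nth _ false) => [|q]; rewrite !szp // => qk.
have qc : q = q %/ c * c + q %% c by rewrite -divn_eq.
have := eb (q %/ c); rewrite ltn_divLR // => /(_ qk)/(congr1 (fun s => nth false s (q %% c))).
by rewrite !nth_take ?ltn_mod // !nth_drop -qc.
Qed.

(** The Lagrange basis polynomial of node [j.+1] among the nodes [1..k]; it turns codewords into
    polynomial values, so that roots can be counted. *)
Definition lagr (j : nat) : {poly F} :=
  (\prod_(p < k | (p : nat) != j)
     ((elt c j.+1 - elt c p.+1)^-1 *: ('X - (elt c p.+1)%:P)))%R.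

Definition msg_poly (m : l.-tuple bool) : {poly F} :=
  (\sum_(j < k) vecm n t m j *: lagr j)%R.

Lemma horner_lagr i j : (lagr j).[elt c i]%R = hcoef n t l i j.
Proof.
rewrite /lagr /hcoef horner_prod; apply: eq_bigr => p _.
by rewrite hornerZ hornerXsubC mulrC.
Qed.

Lemma horner_msg_poly m i : (msg_poly m).[elt c i]%R = evalm n t i m.
Proof.
rewrite /msg_poly /evalm horner_sum; apply: eq_bigr => j _.
by rewrite hornerZ horner_lagr mulrC.
Qed.

Lemma elt_neq i j : i <= n -> j <= n -> i != j -> (elt c i != elt c j)%R.
Proof.
move=> hi hj; apply: contra => /eqP/elt_inj -> //; rewrite inE;
  exact: leq_ltn_trans (cpar_field _ _ _).
Qed.

(** The code is systematic: at the nodes [1..k], distinct because [k <= n], the Lagrange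
    coefficients are Kronecker deltas. *)
Lemma evalm_coord (m : l.-tuple bool) (j : nat) : j < k -> evalm n t j.+1 m = vecm n t m j.
Proof.
move=> jk; rewrite /evalm (bigD1 (Ordinal jk)) //= big1 ?addr0 => [|i ij].
  rewrite /hcoef big1 ?mul1r // => p pj; rewrite divff // subr_eq0.
  by apply: elt_neq; [lia | have := ltn_ord p; lia | lia].
rewrite /hcoef (bigD1 (Ordinal jk)) /=; first by rewrite subrr !mul0r.
by rewrite eq_sym.
Qed.

Lemma size_msg_poly m : size (msg_poly m) <= k.
Proof.
apply: leq_trans (size_sum _ _ _) _; apply/bigmax_leqP => j _.
apply: leq_trans (size_scale_leq _ _) _.
rewrite /lagr scaler_prod; apply: leq_trans (size_scale_leq _ _) _.
rewrite (eq_bigl [in predC1 j]) // -big_enum size_prod_XsubC -cardE.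
by rewrite cardC1 card_ord prednK ?kpar_gt0.
Qed.

(** The difference of the two polynomials has size at most [k]; with [k] distinct roots it vanishes,
    and the coordinates are read off at the first [k] nodes. *)
Lemma evalm_agree (P : pred 'I_n) (w w' : l.-tuple bool) :
  (forall i, P i -> evalm n t (val i).+1 w = evalm n t (val i).+1 w') ->
  k <= #|P| -> w = w'.
Proof.
move=> ag kP.
have pq : msg_poly w = msg_poly w'.
  apply/eqP; rewrite -subr_eq0.
  set rs := [seq elt c (val i).+1 | i <- enum P].
  apply: contraTT kP => nz; rewrite -ltnNge.
  have : size rs < size (msg_poly w - msg_poly w')%R.
    apply: max_poly_roots => //.
      apply/allP => x /mapP[i]; rewrite mem_enum => Pi ->.
      by rewrite /root !hornerE !horner_msg_poly ag // subrr.
    rewrite map_inj_in_uniq ?enum_uniq // => i j _ _ e; apply: val_inj.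
    by apply: contra_eq e => ij; apply: elt_neq; rewrite ?eqSS // ltn_ord.
  rewrite size_map -cardE => h; apply: leq_trans h _.
  apply: leq_trans (size_polyD _ _) _; rewrite size_polyN geq_max.
  by rewrite !size_msg_poly.
by apply: vecm_inj => j jk; rewrite -!evalm_coord // -!horner_msg_poly pq.
Qed.

End Code.

(** * At most one message survives Phase 3 *)

Section Uniqueness.
Variables (I : finType) (M F : eqType) (val : M -> I -> F) (msg : I -> M).
Variables (Hn S1 S2 S3 : {set I}) (t d N : nat).
(** [val m p] is the symbol of message [m] at position [p], and the two equalities compare the
    Phase-1 pairs of [i] and [j]. Below, [N] is the number of honest links guaranteed to a
    survivor. *)
Definition linked i j :=
  (val (msg i) i == val (msg j) i) && (val (msg i) j == val (msg j) j).
Hypothesis agree : forall m m', m != m' -> #|[set p in Hn | val m p == val m' p]| <= d.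
Hypothesis d5 : 5 * d <= t.
Hypothesis cardH : 2 * t + 1 <= #|Hn|.
Hypothesis HN : #|Hn| <= N + t.
Hypothesis S1P : {in S1, forall i, i \in Hn /\ N <= #|[set j in Hn | linked i j]|}.
Hypothesis S2P : {in S2, forall i, i \in S1 /\ N <= #|[set j in S1 | linked i j]|}.
Hypothesis S3P : {in S3, forall i, i \in S2 /\ N <= #|[set j in S2 | linked i j]|}.

Let T m := [set q in Hn | val m q == val (msg q) q].

(* Three sets [T m] with at least [N] points in [Hn], pairwise sharing at most
   [d] of them, do not fit. *)
Lemma two_messages i j p : i \in S1 -> j \in S1 -> p \in S1 ->
  msg i != msg j -> (msg p == msg i) || (msg p == msg j).
Proof.
have TN a : a \in S1 -> N <= #|T (msg a)|.
  case/S1P => _ h; apply: leq_trans h _; apply: subset_leq_card.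
  by apply/subsetP => q; rewrite !inE => /andP[-> /andP[]].
have TT m m' : m != m' -> #|T m :&: T m'| <= d.
  move=> /agree; apply: leq_trans; apply: subset_leq_card; apply/subsetP => q.
  by rewrite !inE => /andP[/andP[-> /eqP->] /andP[_ /eqP->]] /=.
move=> /TN hi /TN hj /TN hp ij; apply: contraT; rewrite negb_or => /andP[pi pj].
have := TT _ _ ij; have := TT _ _ pi; have := TT _ _ pj.
have := subset_leq_card (_ : T (msg i) :|: T (msg j) :|: T (msg p) \subset Hn).
have /[swap]/[apply] : T (msg i) :|: T (msg j) :|: T (msg p) \subset Hn.
  by apply/subsetP => q; rewrite !inE => /orP[/orP[]|] /andP[].
have := cardsUI (T (msg i)) (T (msg j)).
have := cardsUI (T (msg i) :|: T (msg j)) (T (msg p)).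
have : #|(T (msg i) :|: T (msg j)) :&: T (msg p)| <=
    #|T (msg p) :&: T (msg i)| + #|T (msg p) :&: T (msg j)|.
  by rewrite -cardsUI setIC setIUr leq_addr.
(* Inclusion-exclusion gives [3N - 3d <= #|Hn|]; with [2t + 1 <= #|Hn| <= N + t] this forces
   [t + 2 <= 3d], against [5d <= t]. *)
lia.
Qed.

Let G (A : {set I}) m := [set q in A | msg q == m].

(** A neighbour [q] of [p] carries one of the two messages; if it is not that of [p], the link puts
    both [q] and [p] in the agreement set of the two polynomials. Keeping the condition on [p]
    inside the last set makes that set empty as soon as [p] lies outside the agreement set. *)
Lemma linked_group i j : i \in S1 -> j \in S1 -> msg i != msg j ->
  forall (A : {set I}) p, A \subset S1 -> p \in S1 -> msg p = msg i ->
  #|[set q in A | linked p q]| <=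
    #|G A (msg i)| +
    #|[set q in Hn | (val (msg i) q == val (msg j) q) && (val (msg i) p == val (msg j) p)]|.
Proof.
move=> iS jS ij A p AS pS pi; rewrite -cardsUI; apply: leq_trans (leq_addr _ _).
apply: subset_leq_card; apply/subsetP => q; rewrite !inE.
move=> /andP[qA /andP[l1 l2]]; have qS := subsetP AS _ qA.
have /S1P[qH _] := qS; rewrite qA qH /=.
case/orP: (two_messages iS jS qS ij) => /eqP e; first by rewrite e eqxx.
by rewrite -pi -e l1 l2 orbT.
Qed.

Lemma group_large i j : i \in S3 -> j \in S3 -> msg i != msg j -> N <= #|G S1 (msg i)|.
Proof.
move=> iS jS ij.
have S21 : S2 \subset S1 by apply/subsetP => q /S2P[].
have [i2 hi] := S3P iS; have [j2 _] := S3P jS.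
have i1 := subsetP S21 _ i2; have j1 := subsetP S21 _ j2.
set Z := [set q in Hn | val (msg i) q == val (msg j) q].
have Zd : #|Z| <= d := agree ij.
have := linked_group i1 j1 ij S21 i1 erefl.
have : #|[set q in Hn | (val (msg i) q == val (msg j) q)
                      && (val (msg i) i == val (msg j) i)]| <= #|Z|.
  by apply: subset_leq_card; apply/subsetP => q; rewrite !inE => /and3P[-> ->].
move=> h1 h2.
(* The group inside [S2] has at least [N - d >= t + 1 - d > d] members, so one of them avoids
   [Z]. *)
have : 0 < #|G S2 (msg i) :\: Z|.
  have := subset_leq_card (subsetIr (G S2 (msg i)) Z).
  by have := cardsID Z (G S2 (msg i)); lia.
case/card_gt0P => p; rewrite !inE => /andP[pZ /andP[p2 /eqP pi]].
have [p1 hp] := S2P p2; have /S1P[pH _] := p1.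
apply: leq_trans hp _.
apply: leq_trans (linked_group i1 j1 ij (subxx _) p1 pi) _.
(* As [p] is outside [Z], all its [N] links stay within its own group. *)
rewrite [X in _ + X]eq_card0 ?addn0 // => q; rewrite !inE.
by move: pZ; rewrite pH /= => /negbTE->; rewrite !andbF.
Qed.

(** The two groups are disjoint subsets of [Hn], so [2N <= #|Hn| <= N + t]; but [#|Hn| >= 2t + 1]
    gives [N >= t + 1]. *)
Lemma S3_unique i j : i \in S3 -> j \in S3 -> msg i = msg j.
Proof.
move=> iS jS; apply/eqP; apply: contraT => ij.
have hi := group_large iS jS ij.
have := group_large jS iS; rewrite eq_sym => /(_ ij) hj.
have := cardsUI (G S1 (msg i)) (G S1 (msg j)).
have -> : G S1 (msg i) :&: G S1 (msg j) = set0.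
  apply/setP => q; rewrite !inE; apply: contraNF ij.
  by move=> /andP[/andP[_ /eqP<-] /andP[_ /eqP<-]].
have : #|G S1 (msg i) :|: G S1 (msg j)| <= #|Hn|.
  apply: subset_leq_card; apply/subsetP => q; rewrite !inE.
  by case/orP => /andP[/S1P[]].
by rewrite cards0; lia.
Qed.
End Uniqueness.

(** * Executions *)

Lemma hist_step n In Out (P : protocol n In Out) H inp adv r i :
  hist P H inp adv r.+1 i = rcons (hist P H inp adv r i)
    (fun j => if j \in H then hmsg P j (inp j) (hist P H inp adv r j) i else adv r j i).
Proof. by []. Qed.

Lemma size_hist n In Out (P : protocol n In Out) H inp adv r i :
  size (hist P H inp adv r i) = r.
Proof. by elim: r i => //= r IH i; rewrite size_rcons IH. Qed.

Lemma take_hist n In Out (P : protocol n In Out) H inp adv q r i :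
  q <= r -> take q (hist P H inp adv r i) = hist P H inp adv q i.
Proof.
elim: r q => [|r IH] q; first by rewrite leqn0 => /eqP->.
rewrite leq_eqVlt ltnS => /orP[/eqP->|qr]; first by rewrite take_oversize ?size_hist.
by rewrite /= -cats1 takel_cat ?size_hist // IH.
Qed.

Lemma rv_hist n In Out (P : protocol n In Out) H inp adv q r i j : q < r ->
  rv (hist P H inp adv r i) q j =
    if j \in H then hmsg P j (inp j) (hist P H inp adv q j) i else adv q j i.
Proof.
by move=> qr; rewrite /rv -(nth_take _ (ltnSn q)) take_hist //= nth_rcons size_hist ltnn eqxx.
Qed.

Lemma first_out_eq M O (f : seq M -> option O) s r o : r <= size s ->
  f (take r s) = Some o -> (forall r', r' < r -> f (take r' s) = None) ->
  first_out f s = Some o.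
Proof.
move=> rs fr fN; rewrite /first_out.
have -> : (size s).+1 = r + (size s - r).+1 by lia.
rewrite iotaD map_cat filter_cat filter_map (@eq_in_filter _ _ pred0).
  by rewrite filter_pred0 /= add0n fr.
by move=> q; rewrite mem_iota add0n /= => /fN ->.
Qed.

Lemma terminates_at_fun n In Out (P : protocol n In Out) H inp adv i r r' o o' :
  terminates_at P H inp adv i r o -> terminates_at P H inp adv i r' o' -> o = o'.
Proof.
move=> [e f] [e' f']; case: (ltngtP r r') => [/f'|/f|h]; rewrite ?e ?e' //.
by move: e e'; rewrite h => -> [].
Qed.

Lemma pick_unique (T : finType) (A : pred T) x :
  A x -> (forall y, A y -> y = x) -> [pick y | A y] = Some x.
Proof. by move=> Ax Au; case: pickP => [y /Au->|/(_ x)]; rewrite ?Ax. Qed.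

Lemma count_enum (T : finType) (a : pred T) : count a (enum T) = #|[set x | a x]|.
Proof. by rewrite cardsE -sum1_count big_enum_cond -sum1_card. Qed.

Section Run.
Variables (ba : forall n t : nat, protocol n bool bool) (Rba : nat -> nat -> nat).
Variables (C n t l : nat).
Hypothesis nt : 3 * t + 1 <= n.
Hypothesis l0 : 0 < l.
Local Notation N := (n0 C n t).
Local Notation c := (cpar N t l).
Local Notation F := (GF c).
Local Notation R := (Rba N t).
Local Notation Msg := (l.-tuple bool).
Local Notation P := (COOL ba Rba C n t l).

Let c0 : 0 < c. Proof. exact: cpar_gt0. Qed.

Lemma n0_le : N <= n. Proof. by rewrite /n0; case: ifP. Qed.
Definition wQ : 'I_N -> 'I_n := widen_ord n0_le.
Lemma wQ_inj : injective wQ.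
Proof. by move=> a b e; apply: val_inj; exact: (congr1 val e). Qed.
Lemma n0_ge : 3 * t + 1 <= N. Proof. by rewrite /n0; case: ifP. Qed.
Lemma kpar_le_n0 : kpar t <= N. Proof. by have := n0_ge; rewrite /kpar; lia. Qed.

(** * Local variables read only a prefix of the history *)

Section Prefix.
Variables (i : 'I_n) (m : Msg) (h : seq (msgvec n)) (q : nat).

(** One-step unfoldings, still available once [s1], [s2] and [s3] are made opaque. *)
Lemma s1E : s1 C t i m h = (N - t <= cnt C t (u1 C t i m h)).
Proof. by []. Qed.
Lemma s2E : s2 C t i m h = s1 C t i m h && (N - t <= cnt C t (u2 C t i m h)).
Proof. by []. Qed.
Lemma s3E : s3 C t i m h = s2 C t i m h && (N - t <= cnt C t (u3 C t i m h)).
Proof. by []. Qed.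

Lemma p1_take : 0 < q -> p1 C t l (take q h) = p1 C t l h.
Proof. by move=> q0; rewrite /p1 /rv nth_take. Qed.
Lemma s1_take : 0 < q -> s1 C t i m (take q h) = s1 C t i m h.
Proof. by move=> q0; rewrite /s1 /u1 p1_take. Qed.
Lemma s2_take : 1 < q -> s2 C t i m (take q h) = s2 C t i m h.
Proof.
by move=> q1; rewrite /s2 /u2 /u1 /ind1 /rv p1_take ?s1_take ?nth_take //; lia.
Qed.
Lemma s3_take : 2 < q -> s3 C t i m (take q h) = s3 C t i m h.
Proof.
move=> q1; rewrite /s3 /u3 /u2 /u1 /ind2 /ind1 /rv.
by rewrite p1_take ?s2_take ?s1_take ?nth_take //; lia.
Qed.
Lemma ind3_take : 3 < q -> ind3 C t i m (take q h) = ind3 C t i m h.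
Proof.
move=> q1; rewrite /ind3 /ind2 /ind1 /rv.
by rewrite s3_take ?s2_take ?s1_take ?nth_take //; lia.
Qed.
Lemma vote_take : 3 < q -> vote C t i m (take q h) = vote C t i m h.
Proof. by move=> q1; rewrite /vote ind3_take. Qed.

Lemma bahist_take r : bahist C t (take (4 + r) h) = take r (bahist C t h).
Proof. by rewrite /bahist -map_take take_drop addnC. Qed.

Lemma dec_take : 4 + R <= q -> dec ba Rba C t i m (take q h) = dec ba Rba C t i m h.
Proof.
move=> qR; have e : take q h = take (4 + (q - 4)) h by congr (take _ h); lia.
rewrite /dec vote_take ?e ?bahist_take; last lia.
by rewrite take_takel //; lia.
Qed.
Lemma ynew_take : 3 < q -> ynew C t i m (take q h) = ynew C t i m h.
Proof. by move=> q3; rewrite /ynew ind3_take ?p1_take //; lia. Qed.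
Lemma core_result_take : 4 + R < q ->
  core_result ba Rba C t i m (take q h) = core_result ba Rba C t i m h.
Proof.
move=> qR; rewrite /core_result dec_take ?s3_take; [|lia..].
rewrite /decode /zval; case: ifP => // _; case: ifP => // _.
by rewrite ynew_take ?ind3_take ?p1_take /rv ?nth_take //; lia.
Qed.
End Prefix.

Variables (H : {set 'I_n}) (inp : 'I_n -> Msg) (adv : adversary n).
Hypothesis fH : #|~: H| <= t.

(** [6 + R] rounds suffice for both variants of COOL; all quantities of a run are evaluated on this
    one history. *)
Definition full_hist (i : 'I_n) := hist P H inp adv (6 + R) i.
Local Notation hh := full_hist.
Local Notation S1 i := (s1 C t i (inp i) (hh i)).
Local Notation S2 i := (s2 C t i (inp i) (hh i)).
Local Notation S3 i := (s3 C t i (inp i) (hh i)).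
Local Notation ynew' i := (ynew C t i (inp i) (hh i)).
Local Notation dec' i := (dec ba Rba C t i (inp i) (hh i)).
Local Notation core' i := (core_result ba Rba C t i (inp i) (hh i)).

Lemma size_take_hh q i : q <= 6 + R -> size (take q (hh i)) = q.
Proof. by move=> qR; rewrite take_hist ?size_hist. Qed.

Lemma rv_hh q i j : q < 6 + R -> rv (hh i) q j =
  if j \in H then hmsg P j (inp j) (take q (hh j)) i else adv q j i.
Proof. by move=> qR; rewrite (rv_hist _ _ _ _ _ _ qR) (take_hist _ _ _ _ _ (ltnW qR)). Qed.

Lemma cool_out_early q i : q < 4 + R -> p_out P i (inp i) (take q (hh i)) = None.
Proof.
move=> qR; have q6 : q < 6 + R by lia.
by rewrite /= /cool_out (size_take_hh _ (ltnW q6)) qR q6; case: (smallQ _ _ _).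
Qed.

Lemma hmsg_core q i j : q < 4 + R ->
  hmsg P i (inp i) (take q (hh i)) j =
  core_send ba Rba C t i (inp i) (take q (hh i)) j.
Proof.
move=> qR; rewrite /hmsg cool_out_early //= /cool_send size_take_hh; last lia.
by rewrite (_ : (q == 5 + R) = false) ?andbF //; lia.
Qed.

(** The prefix lemmas replace the sender's indicators by their values on the full history, where
    they can be compared with those of the receivers. *)
Lemma core_sendE q i j : q <= 6 + R -> core_send ba Rba C t i (inp i) (take q (hh i)) j =
  if ~~ ((i < N) && (j < N)) then None else
  if q == 0 then (if j == i then None else
     Some (bits_of (y0 C t (inp i) j) ++ bits_of (y0 C t (inp i) i)))
  else if q == 1 then (if j == i then None else Some [:: S1 i])
  else if q == 2 then (if (j != i) && S1 i && ~~ S2 i then Some [:: false] else None)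
  else if q == 3 then (if (j != i) && S2 i && ~~ S3 i then Some [:: false] else None)
  else if q < 4 + R then bamsg ba C t i (inp i) (take q (hh i)) j
  else if q == 4 + R then
    (if dec' i && ~~ S3 i && (j != i) && ~~ ind3 C t i (inp i) (hh i) j
     then Some (bits_of (ynew' i)) else None)
  else None.
Proof.
move=> qR; rewrite /core_send (size_take_hh _ qR).
case: (~~ _); first by [].
case: (eqVneq q 0) => [_|q0]; first by [].
case: (eqVneq q 1) => [->|q1]; first by rewrite s1_take.
case: (eqVneq q 2) => [->|q2]; first by rewrite s1_take ?s2_take.
case: (eqVneq q 3) => [->|q3]; first by rewrite s2_take ?s3_take.
case: (q < 4 + R); first by [].
case: (eqVneq q (4 + R)) => [->|_]; last by [].
by rewrite dec_take ?s3_take ?ind3_take ?ynew_take.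
Qed.

Local Opaque s1 s2 s3 hist.

Lemma cool_sendE q i j : q <= 6 + R ->
  cool_send ba Rba C t i (inp i) (take q (hh i)) j =
  if smallQ C n t && (q == 5 + R) then q_send ba Rba C t i (inp i) (take q (hh i)) j
  else core_send ba Rba C t i (inp i) (take q (hh i)) j.
Proof. by move=> qR; rewrite /cool_send size_take_hh. Qed.

(** * What honest core members learn about each other *)

Section Honest.
Variables i j : 'I_n.
Hypotheses (iN : i < N) (jN : j < N) (jH : j \in H).

Lemma rv0 : j != i -> rv (hh i) 0 j =
  Some (bits_of (y0 C t (inp j) i) ++ bits_of (y0 C t (inp j) j)).
Proof.
by move=> ji; rewrite rv_hh // jH hmsg_core ?core_sendE // iN jN /= eq_sym (negPf ji).
Qed.

Lemma p1E : j != i -> p1 C t l (hh i) j = (y0 C t (inp j) i, y0 C t (inp j) j).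
Proof.
move=> ji; rewrite /p1 rv0 //= size_cat !size_bits_of eqxx.
rewrite take_size_cat ?drop_size_cat ?size_bits_of //.
by rewrite !(bits_ofK c0).
Qed.

Lemma u1E : u1 C t i (inp i) (hh i) j =
  linked (@y0 C n t l) inp i j.
Proof.
rewrite /u1 /linked; case: (eqVneq j i) => [->|ji]; first by rewrite !eqxx.
by rewrite p1E //= xpair_eqE [in LHS]eq_sym [X in _ && X]eq_sym.
Qed.

Lemma ind1E : ind1 C t i (inp i) (hh i) j = S1 j.
Proof.
rewrite /ind1; case: (eqVneq j i) => [->//|ji].
by rewrite rv_hh // jH hmsg_core ?core_sendE // iN jN /= eq_sym (negPf ji).
Qed.

(** Silence leaves the recorded [ind1] in force, and [S2 j] differs from [S1 j] only when [j] has
    sent [false]. *)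
Lemma ind2E : ind2 C t i (inp i) (hh i) j = S2 j.
Proof.
rewrite /ind2 ind1E; case: (eqVneq j i) => [->//|ji].
rewrite rv_hh // jH hmsg_core ?core_sendE // iN jN /= eq_sym ji /=.
by rewrite s2E; case: (S1 j) => //=; case: (_ <= _).
Qed.

Lemma ind3E : ind3 C t i (inp i) (hh i) j = S3 j.
Proof.
rewrite /ind3 ind2E; case: (eqVneq j i) => [->//|ji].
rewrite rv_hh // jH hmsg_core ?core_sendE // iN jN /= eq_sym ji /=.
by rewrite s3E; case: (S2 j) => //=; case: (_ <= _).
Qed.
End Honest.

(** * Counting inside the core group *)

Definition honestQ := [set i in H | i < N].
Definition byzQ := [set i : 'I_n | (i < N) && (i \notin H)].
Local Notation HQ := honestQ.

Lemma card_Q : #|[set i : 'I_n | i < N]| = N.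
Proof.
have e : [set i : 'I_n | i < N] = wQ @: [set: 'I_N].
  apply/setP => i; rewrite inE; apply/idP/imsetP => [iN|[j _ ->]]; last exact: (ltn_ord j).
  by exists (Ordinal iN) => //; apply: val_inj.
by rewrite e (card_imset _ wQ_inj) cardsT card_ord.
Qed.

Lemma card_HQ : #|HQ| + #|byzQ| = N.
Proof.
rewrite -[RHS]card_Q -[RHS](cardsID H); congr (_ + _);
  by apply: eq_card => i; rewrite !inE // andbC.
Qed.

Lemma card_byzQ : #|byzQ| <= t.
Proof.
by apply: leq_trans fH; apply: subset_leq_card; apply/subsetP => i; rewrite !inE => /andP[].
Qed.

Lemma cnt_le (A : pred 'I_n) : cnt C t A <= #|[set j in HQ | A j]| + #|byzQ|.
Proof.
rewrite -cardsUI; apply: leq_trans (leq_addr _ _); apply: subset_leq_card.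
by apply/subsetP => j; rewrite !inE => /andP[-> ->]; case: (j \in H).
Qed.

Lemma cnt_ge (A : pred 'I_n) : #|[set j in HQ | A j]| <= cnt C t A.
Proof.
by apply: subset_leq_card; apply/subsetP => j; rewrite !inE => /andP[/andP[_ ->] ->].
Qed.

Lemma cnt_all (A : pred 'I_n) : {in HQ, forall j, A j} -> N - t <= cnt C t A.
Proof.
move=> hA; apply: leq_trans (cnt_ge A); rewrite -card_HQ.
have -> : [set j in HQ | A j] = HQ.
  by apply/setP => j; rewrite inE; case: (boolP (j \in HQ)) => // /hA.
by have := card_byzQ; lia.
Qed.

Lemma HQ_ge : 2 * t + 1 <= #|HQ|.
Proof. by have := card_HQ; have := card_byzQ; have := n0_ge; lia. Qed.

Lemma HQ_gt0 : exists i, i \in HQ.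
Proof. by apply/card_gt0P; have := HQ_ge; lia. Qed.

(** Two sets of at least [N - t] among [N] positions share at least [N - 2t >= t + 1 >= kpar t]. *)
Lemma cnt_inter (A B : pred 'I_n) : N - t <= cnt C t A -> N - t <= cnt C t B ->
  kpar t <= cnt C t [predI A & B].
Proof.
rewrite /cnt => hA hB.
have := cardsUI [set j : 'I_n | (j < N) && A j] [set j : 'I_n | (j < N) && B j].
have -> : [set j : 'I_n | (j < N) && A j] :&: [set j : 'I_n | (j < N) && B j] =
          [set j : 'I_n | (j < N) && [predI A & B] j].
  by apply/setP => j; rewrite !inE; case: (j < N).
have : #|[set j : 'I_n | (j < N) && A j] :|: [set j : 'I_n | (j < N) && B j]| <= N.
  rewrite -[X in _ <= X]card_Q; apply: subset_leq_card; apply/subsetP => j.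
  by rewrite !inE => /orP[] /andP[].
have := n0_ge; move: hA hB; rewrite /kpar /=; lia.
Qed.

Lemma y0_agree (m m' : Msg) : m != m' ->
  #|[set j : 'I_n | (j < N) && (y0 C t m j == y0 C t m' j)]| < kpar t.
Proof.
move=> mm; rewrite ltnNge; apply: contra mm => ge; apply/eqP.
apply: (evalm_agree l0 kpar_le_n0
  (P := fun i : 'I_N => y0 C t m (wQ i) == y0 C t m' (wQ i))).
  by move=> i /eqP.
apply: leq_trans ge _; rewrite -(card_imset _ wQ_inj).
apply: subset_leq_card; apply/subsetP => j; rewrite inE => /andP[jN e].
have je : j = wQ (Ordinal jN) by apply: val_inj.
by rewrite je; apply: imset_f; rewrite unfold_in -je.
Qed.

(** Unique decoding: both messages match [z] on [kpar t] common positions. *)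
Lemma y0_majority (m m' : Msg) (z : 'I_n -> F) :
  N - t <= cnt C t (fun j => y0 C t m j == z j) ->
  N - t <= cnt C t (fun j => y0 C t m' j == z j) -> m = m'.
Proof.
move=> /cnt_inter h /h; apply: contraTeq => /y0_agree; rewrite -ltnNge.
apply: leq_ltn_trans; apply: subset_leq_card; apply/subsetP => j; rewrite !inE /=.
by move=> /andP[-> /andP[/eqP-> /eqP->]] /=.
Qed.

Lemma S3_same i j : i \in HQ -> j \in HQ -> S3 i -> S3 j -> inp i = inp j.
Proof.
move=> iQ jQ i3 j3.
have lnk a q : a \in HQ -> q \in HQ ->
    u1 C t a (inp a) (hh a) q = linked (@y0 C n t l) inp a q.
  by rewrite !inE => /andP[_ aN] /andP[qH qN]; rewrite u1E.
(* Of the [N - t] counted positions at most [#|byzQ|] are dishonest, and [N - #|byzQ| = #|HQ|]. *)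
have few (A : pred 'I_n) (B : {set 'I_n}) :
    [set j in HQ | A j] \subset B -> N - t <= cnt C t A -> #|HQ| - t <= #|B|.
  move=> /subset_leq_card AB h; have := cnt_le A; have := card_HQ; lia.
(* The agreement bound [d] is [(kpar t).-1 = t %/ 5], as left by [y0_agree]. *)
apply: (@S3_unique _ _ _ (@y0 C n t l) inp HQ [set i in HQ | S1 i]
  [set i in HQ | S2 i] [set i in HQ | S3 i] t (kpar t).-1 (#|HQ| - t)).
- move=> m m' /y0_agree h; rewrite -ltnS prednK ?kpar_gt0 //.
  apply: leq_ltn_trans h; apply: subset_leq_card; apply/subsetP => q.
  by rewrite !inE => /andP[/andP[_ ->]].
- by rewrite /kpar; lia.
- exact: HQ_ge.
- by rewrite addnC -leq_subLR.
- move=> a /setIdP[aQ]; rewrite s1E => h; split => //; apply: few h.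
  by apply/subsetP => q /setIdP[qQ]; rewrite lnk // inE qQ.
- move=> a /setIdP[aQ]; rewrite s2E => /andP[a1 h]; split; first by rewrite inE aQ.
  apply: few h; apply/subsetP => q /setIdP[qQ]; rewrite /u2 lnk // a1 /=.
  have [/setIdP[_ aN] /setIdP[qH qN]] := (aQ, qQ).
  by rewrite ind1E // => /andP[ql q1]; rewrite !inE ql q1 qH qN.
- move=> a /setIdP[aQ]; rewrite s3E => /andP[a2 h]; split; first by rewrite inE aQ.
  apply: few h; apply/subsetP => q /setIdP[qQ].
  have [/setIdP[_ aN] /setIdP[qH qN]] := (aQ, qQ).
  rewrite /u3 /u2 lnk // a2 ind2E //= => /andP[/andP[ql _] q2].
  by rewrite !inE ql q2 qH qN.
- by rewrite inE iQ.
- by rewrite inE jQ.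
Qed.

(** Equal inputs make all honest links hold, so no honest core member ever falls below the
    threshold; validity rests on this. *)
Lemma S_all (w : Msg) : (forall i, i \in H -> inp i = w) ->
  {in HQ, forall i, S3 i}.
Proof.
move=> hw.
have u i j : i \in HQ -> j \in HQ -> u1 C t i (inp i) (hh i) j.
  by move=> /setIdP[iH iN] /setIdP[jH jN]; rewrite u1E // /linked (hw i) // (hw j) // !eqxx.
have h1 : {in HQ, forall i, S1 i}.
  by move=> i iQ; rewrite s1E; apply: cnt_all => j jQ; apply: u.
have h2 : {in HQ, forall i, S2 i}.
  move=> i iQ; rewrite s2E h1 //=; apply: cnt_all => j jQ.
  have [/setIdP[_ iN] /setIdP[jH jN]] := (iQ, jQ).
  by rewrite /u2 u // ind1E // [S1 j]h1 // implybT.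
move=> i iQ; rewrite s3E h2 //=; apply: cnt_all => j jQ.
have [/setIdP[_ iN] /setIdP[jH jN]] := (iQ, jQ).
by rewrite /u3 /u2 u // ind1E // ind2E // [S1 j]h1 // [S2 j]h2 // !implybT.
Qed.

(** * The embedded binary agreement *)

Definition ba_input (i : 'I_N) := vote C t (wQ i) (inp (wQ i)) (hh (wQ i)).
Definition ba_honest := [set i : 'I_N | wQ i \in H].
(** The agreement starts after four rounds of COOL, hence the shift. *)
Definition ba_adv : adversary N := fun r j i => adv (4 + r) (wQ j) (wQ i).
Local Notation bah i := (bahist C t (hh (wQ i))).
Local Notation bhist := (hist (ba N t) ba_honest ba_input ba_adv).

Lemma insub_wQ (i : 'I_N) : insub (wQ i : nat) = Some i.
Proof. exact: (valK i). Qed.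

Lemma insub_ordQ (i : 'I_N) : (insub (i : nat) : option 'I_n) = Some (wQ i).
Proof. exact: (valK (wQ i)). Qed.

Lemma honestQ_wQ (i : 'I_n) : i \in HQ -> exists2 b : 'I_N, b \in ba_honest & i = wQ b.
Proof.
move=> /setIdP[iH iN]; have e : i = wQ (Ordinal iN) by apply: val_inj.
by exists (Ordinal iN); rewrite // inE -e.
Qed.

Lemma wQ_honestQ (b : 'I_N) : (wQ b \in HQ) = (b \in ba_honest).
Proof. by rewrite !inE (ltn_ord b : wQ b < N) andbT. Qed.

Lemma card_byz_ba : #|~: ba_honest| <= t.
Proof.
apply: leq_trans fH; rewrite -(card_imset _ wQ_inj); apply: subset_leq_card.
by apply/subsetP => _ /imsetP[i + ->]; rewrite !inE.
Qed.

Lemma bamsgE r i j : r <= R ->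
  bamsg ba C t (wQ i) (inp (wQ i)) (take (4 + r) (hh (wQ i))) (wQ j) =
  hmsg (ba N t) i (ba_input i) (take r (bah i)) j.
Proof. by move=> rR; rewrite /bamsg !insub_wQ vote_take // bahist_take. Qed.

Lemma hmsg_ba r i j : r < R ->
  hmsg P (wQ i) (inp (wQ i)) (take (4 + r) (hh (wQ i))) (wQ j) =
  hmsg (ba N t) i (ba_input i) (take r (bah i)) j.
Proof.
move=> rR; have r4 : 4 + r < 4 + R by rewrite ltn_add2l.
rewrite hmsg_core // core_sendE; last by lia.
rewrite r4 (ltn_ord i : wQ i < N) (ltn_ord j : wQ j < N).
by apply: bamsgE; apply: ltnW.
Qed.

Lemma size_bahist i : size (bah i) = 2 + R.
Proof. by rewrite size_map size_drop size_hist; lia. Qed.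

Lemma ba_hist r i : r <= R -> bhist r i = take r (bah i).
Proof.
elim: r i => [|r IH] i rR; first by rewrite take0.
pose d := (fun _ => None) : msgvec n.
have rs : r < size (bah i) by rewrite size_bahist; lia.
rewrite (take_nth (restr d)) // hist_step IH ?(ltnW rR) //.
congr rcons; apply: functional_extensionality => j.
rewrite (nth_map d); last by rewrite size_map in rs.
rewrite nth_drop /restr insub_ordQ -/(rv (hh (wQ i)) (4 + r) (wQ j)) rv_hh; last lia.
by rewrite inE IH ?(ltnW rR) // hmsg_ba.
Qed.

Variable B : nat.
Hypothesis baP : forall (H : {set 'I_N}) (inp : 'I_N -> bool) (adv : adversary N),
  #|~: H| <= t ->
  [/\ forall i, i \in H -> exists r o, r <= R /\ terminates_at (ba N t) H inp adv i r o,
      forall i j r1 r2 o1 o2, i \in H -> j \in H ->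
        terminates_at (ba N t) H inp adv i r1 o1 ->
        terminates_at (ba N t) H inp adv j r2 o2 -> o1 = o2,
      forall b, (forall i, i \in H -> inp i = b) ->
        forall i r o, i \in H -> terminates_at (ba N t) H inp adv i r o -> o = b
    & bits_sent (ba N t) H inp adv R <= B].

(** [first_out] picks the output on the shortest prefix that has one, which is the output at the
    stopping time. *)
Lemma dec_terminates i r o : r <= R ->
  terminates_at (ba N t) ba_honest ba_input ba_adv i r o -> dec' (wQ i) = o.
Proof.
move=> rR [e f]; rewrite /dec insub_wQ; set s := take R _.
have sE q : q <= R -> take q s = bhist q i by move=> qR; rewrite ba_hist // take_takel.
rewrite (@first_out_eq _ _ _ s r o) ?sE //.
  by rewrite size_takel // size_bahist; lia.
by move=> q qr; rewrite sE ?f //; lia.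
Qed.

Lemma decision : exists b, {in HQ, forall i, dec' i = b} /\
  (forall v, {in HQ, forall i, vote C t i (inp i) (hh i) = v} -> b = v).
Proof.
have [term cons valid _] := baP ba_input ba_adv card_byz_ba.
have [i0 /honestQ_wQ[b0 b0H _]] := HQ_gt0.
have [r0 [o0 [r0R t0]]] := term _ b0H.
exists o0; split=> [i /honestQ_wQ[b bH ->]|v hv].
  have [r [o [rR tm]]] := term _ bH; rewrite (dec_terminates rR tm).
  exact: cons bH b0H tm t0.
by apply: (valid v) b0H t0 => i iH; apply: hv; rewrite wQ_honestQ.
Qed.

Lemma cnt_ind3 i : i \in HQ ->
  cnt C t (ind3 C t i (inp i) (hh i)) <= #|[set j in HQ | S3 j]| + #|byzQ|.
Proof.
move=> /setIdP[_ iN]; apply: leq_trans (cnt_le _) _; rewrite leq_add2r.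
apply: subset_leq_card; apply/subsetP => j /setIdP[jQ].
by have /setIdP[jH jN] := jQ; rewrite ind3E // inE jQ.
Qed.

(** Of the [2t + 1] positive indicators behind a vote, at most [t] come from dishonest
    processors. *)
Lemma S3_many i : i \in HQ -> vote C t i (inp i) (hh i) -> t < #|[set j in HQ | S3 j]|.
Proof. by move=> /cnt_ind3; rewrite /vote; have := card_byzQ; lia. Qed.

(** * Phase 4 after decision 1 *)

Section Decided.
Variable w : Msg.
Hypothesis S3w : {in HQ, forall i, S3 i -> inp i = w}.
Hypothesis S3t : t < #|[set j in HQ | S3 j]|.
Hypothesis dec1 : {in HQ, forall i, dec' i}.

(** The honest survivors all sent the symbol of [w] at [i]; being more than [t], they form a strict
    majority of the recorded survivors. *)
Lemma ynewE i : i \in HQ -> ~~ S3 i -> ynew' i = y0 C t w i.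
Proof.
move=> iQ i3; have /setIdP[iH iN] := iQ;
apply: mode_majority; rewrite count_map count_filter size_map size_filter !count_enum.
have szle : #|[set j : 'I_n | (j < N) && ind3 C t i (inp i) (hh i) j]| <=
    #|[set j in HQ | S3 j]| + #|byzQ| := cnt_ind3 iQ.
apply: leq_ltn_trans szle _.
apply: (@leq_trans (#|[set j in HQ | S3 j]|).*2).
  by rewrite -addnn ltn_add2l; apply: leq_ltn_trans card_byzQ S3t.
rewrite leq_double; apply: subset_leq_card; apply/subsetP => j /setIdP[jQ j3].
have /setIdP[jH jN] := jQ; rewrite inE /= ind3E // j3 jN !andbT.
by rewrite p1E ?(S3w jQ j3) //=; apply: contraNneq i3 => <-.
Qed.

Lemma zvalE i j : i \in HQ -> ~~ S3 i -> j \in HQ ->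
  zval Rba C t i (inp i) (hh i) j = y0 C t w j.
Proof.
move=> iQ i3 jQ; rewrite /zval; case: eqVneq => [->|ji]; first exact: ynewE.
have [/setIdP[iH iN] /setIdP[jH jN]] := (iQ, jQ).
rewrite ind3E //; case: ifP => [j3|/negbT j3]; first by rewrite p1E // (S3w jQ j3).
(* After decision 1, [j] has not stopped yet in either variant, so its Phase-4 symbol is really
   sent. *)
have out : p_out P j (inp j) (take (4 + R) (hh j)) = None.
  rewrite /= /cool_out size_take_hh ?leq_add2r // ltnn dec_take // (dec1 jQ) /=.
  by rewrite !ltn_add2r; case: (smallQ _ _ _).
rewrite rv_hh ?ltn_add2r // jH /hmsg out -[p_send _ _ _ _ _]/(cool_send _ _ _ _ _ _ _ _).
rewrite cool_sendE ?leq_add2r // eqn_add2r andbF core_sendE ?leq_add2r // iN jN /=.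
rewrite ltnn eqxx (dec1 jQ) j3 [i == j]eq_sym ji ind3E // i3 /=.
by rewrite size_bits_of eqxx (bits_ofK c0) ynewE.
Qed.

Lemma decodeE i : i \in HQ -> ~~ S3 i -> decode Rba C t i (inp i) (hh i) = Some w.
Proof.
move=> iQ i3.
have wz : N - t <= cnt C t (fun j : 'I_n => y0 C t w j == zval Rba C t i (inp i) (hh i) j).
  by apply: cnt_all => j jQ; rewrite zvalE.
by apply: pick_unique => // m mz; apply: y0_majority mz wz.
Qed.

Lemma core_decided i : i \in HQ -> core' i = Some w.
Proof.
move=> iQ; rewrite /core_result (dec1 iQ) /=.
by case: ifP => [i3|/negbT i3]; [rewrite (S3w iQ i3) | rewrite decodeE].
Qed.
End Decided.

(** The last clause serves the variant in which decision 0 makes a processor output [phi] before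
    [core_result] is consulted. *)
Lemma core_agree : exists o, {in HQ, forall i, core' i = o} /\
  (forall w, (forall i, i \in H -> inp i = w) -> o = Some w) /\
  (forall i, i \in HQ -> ~~ dec' i -> o = None).
Proof.
have [i0 i0Q] := HQ_gt0.
have [[] [db dv]] := decision; last first.
  exists None; split; first by move=> i iQ; rewrite /core_result db.
  split=> // w hw.
  (* Decision 0 cannot occur with equal inputs: all honest core members survive Phase 3 and
     therefore vote 1. *)
  suff : false = true by [].
  apply: dv => i iQ; rewrite /vote; apply: leq_trans HQ_ge _.
  apply: leq_trans (cnt_ge _); apply: subset_leq_card; apply/subsetP => j jQ.
  have [/setIdP[_ iN] /setIdP[jH jN]] := (iQ, jQ).
  by rewrite !inE ind3E // jH jN (S_all hw jQ).
(* Were all honest votes 0, validity of the binary agreement would give decision 0. *)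
have [i iQ vi] : exists2 i, i \in HQ & vote C t i (inp i) (hh i).
  apply/exists_inP; apply: contraT => /exists_inPn nv; suff : true = false by [].
  by apply: dv => i iQ; apply/negbTE/nv.
have S3t := S3_many iQ vi.
have [a /setIdP[aQ a3]] : exists a, a \in [set j in HQ | S3 j].
  by apply/card_gt0P; apply: leq_ltn_trans S3t.
have S3w : {in HQ, forall j, S3 j -> inp j = inp a}.
  by move=> j jQ j3; apply: S3_same.
exists (Some (inp a)); split.
  by move=> j jQ; apply: (core_decided S3w S3t) => // q qQ; apply: db.
split=> [w hw|j jQ]; last by rewrite db.
by have /setIdP[aH _] := aQ; rewrite hw.
Qed.

(** * Processors outside the core group *)

Lemma rv_Q (i j : 'I_n) : smallQ C n t -> j \in HQ -> ~~ (i < N) ->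
  rv (hh i) (5 + R) j = Some (if core' j is Some w
     then true :: bits_of (evalm N t j.+1 w) else [:: false]).
Proof.
move=> sm /setIdP[jH jN] iN; have q6 : 5 + R <= 6 + R by rewrite leq_add2r.
rewrite rv_hh ?ltn_add2r // jH /hmsg.
have out : p_out P j (inp j) (take (5 + R) (hh j)) = None.
  by rewrite /= /cool_out size_take_hh // sm /= ltn_add2r.
rewrite out -[p_send _ _ _ _ _]/(cool_send _ _ _ _ _ _ _ _).
rewrite /cool_send size_take_hh // sm eqxx /= /q_send size_take_hh // jN iN eqxx /=.
by rewrite core_result_take ?ltn_add2r.
Qed.

Lemma outsider_agree (i : 'I_n) o : smallQ C n t -> ~~ (i < N) ->
  {in HQ, forall j, core' j = o} -> outsider_result Rba C t l (hh i) = o.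
Proof.
move=> sm iN ho; rewrite /outsider_result; case: o ho => [w|] ho; last first.
  by rewrite ifT //; apply: cnt_all => j jQ; rewrite rv_Q // ho.
have vw j : j \in HQ -> rv (hh i) (5 + R) j = Some (true :: bits_of (evalm N t j.+1 w)).
  by move=> jQ; rewrite rv_Q // ho.
(* Only dishonest core members can send the marker here, and there are at most [t < N - t] of
   them. *)
rewrite ifF; last first.
  apply/negbTE; rewrite -ltnNge; apply: leq_ltn_trans (cnt_le _) _.
  rewrite eq_card0; first by have := card_byzQ; have := n0_ge; lia.
  by move=> j; rewrite !inE; apply/negP => /andP[jQ]; rewrite vw // inE.
have nw : N - t <= cnt C t (fun j : 'I_n =>
    rv (hh i) (5 + R) j == Some (true :: bits_of (evalm N t j.+1 w))).
  by apply: cnt_all => j jQ; rewrite vw.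
(* Two accepted candidates would share [kpar t] senders, hence agree on too many symbols. *)
apply: pick_unique => // m nm; apply/eqP; apply: contraT => /y0_agree.
rewrite ltnNge => /negP[]; apply: leq_trans (cnt_inter nm nw) _.
apply: subset_leq_card; apply/subsetP => j; rewrite !inE => /andP[-> /andP[/eqP e1 /eqP e2]].
by move: e2; rewrite e1 => -[/(can_inj (bits_ofK c0)) e]; rewrite /y0 e eqxx.
Qed.

(** The stopping time is [6 + R] if a small core group serves the others; otherwise it is [4 + R]
    after decision 0 and [5 + R] after decision 1. *)
Lemma agreement : exists o, {in H, forall i, exists r, r <= 6 + R /\
    terminates_at P H inp adv i r o} /\
  (forall w, (forall i, i \in H -> inp i = w) -> o = Some w).
Proof.
have [o [co [ov od]]] := core_agree; exists o; split => // i iH.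
have early q : q < 4 + R -> p_out P i (inp i) (hist P H inp adv q i) = None.
  by move=> qR; rewrite -(cool_out_early i qR) take_hist //; lia.
have outE q : q <= 6 + R -> p_out P i (inp i) (hist P H inp adv q i) =
    cool_out ba Rba C t i (inp i) (take q (hh i)).
  by move=> qR; rewrite take_hist.
have [sm|bg] := boolP (smallQ C n t).
  exists (6 + R); split => //; split.
    rewrite outE // /cool_out size_take_hh // sm ltnn /=.
    have -> : take (6 + R) (hh i) = hh i by rewrite take_oversize // size_hist.
    case: ifP => [iN|/negbT iN]; first by rewrite co // inE iH iN.
    by rewrite (outsider_agree sm iN co).
  move=> q qR; rewrite outE ?(ltnW qR) // /cool_out size_take_hh ?(ltnW qR) //.
  by rewrite sm qR.
have iQ : i \in HQ.
  by rewrite inE iH /n0 (negbTE bg) ltn_ord.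
have [di|di] := boolP (dec' i); last first.
  exists (4 + R); split; first by rewrite leq_add2r.
  split=> //; rewrite outE ?leq_add2r // /cool_out size_take_hh ?leq_add2r // bg ltnn.
  by rewrite dec_take // di (od i).
exists (5 + R); split; first by rewrite leq_add2r.
split=> [|q].
  rewrite outE ?leq_add2r // /cool_out size_take_hh ?leq_add2r // bg ltnn.
  by rewrite dec_take ?leq_add2r // di ltn_add2r /= core_result_take ?ltn_add2r // co.
move=> q5; case: (ltnP q (4 + R)) => [/early//|q4]; have -> : q = 4 + R by lia.
rewrite outE ?leq_add2r // /cool_out size_take_hh ?leq_add2r // bg ltnn.
by rewrite dec_take // di ltn_add2r.
Qed.

(** * Communicated bits *)

Lemma msg_small q (i j : 'I_n) : q < 6 + R -> ~~ (4 <= q < 4 + R) ->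
  msize (hmsg P i (inp i) (take q (hh i)) j) <= if i < N then c + c + 1 else 0.
Proof.
(* A Phase-1 pair takes [2c] bits, a tagged output symbol [c + 1], an indicator one. *)
move=> qR qn; have lt_c : c < c + c + 1 by lia.
have gt_c : 0 < c + c + 1 by lia.
rewrite /hmsg; case: (p_out _ _ _ _) => [//|].
rewrite -[p_send _ _ _ _ _]/(cool_send _ _ _ _ _ _ _ _) cool_sendE ?(ltnW qR) //.
case: (smallQ C n t && (q == 5 + R)).
  rewrite /q_send; case: (i < N) => //=; case: ifP => // _.
  by case: (core_result _ _ _ _ _ _ _) => [m|] /=; rewrite ?size_bits_of.
rewrite core_sendE ?(ltnW qR) //; case: (i < N) => //=; case: (j < N) => //=.
case: eqP => [_|q0].
  by case: (j == i) => //=; rewrite size_cat !size_bits_of addn1.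
case: eqP => [_|q1]; first by case: (j == i).
case: eqP => [_|q2]; first by case: ifP.
case: eqP => [_|q3]; first by case: ifP.
case: ifP => [q4|_]; first by move: qn; rewrite q4 andbT -ltnNge; move: q0 q1 q2 q3; lia.
by case: (q == 4 + R) => //; case: ifP => //= _; rewrite size_bits_of; apply: ltnW.
Qed.

Lemma sum_Q (A : pred 'I_n) (G : 'I_n -> nat) :
  (forall i : 'I_n, ~~ (i < N) -> G i = 0) ->
  \sum_(i | A i) G i = \sum_(b : 'I_N | A (wQ b)) G (wQ b).
Proof.
move=> G0; rewrite (bigID (fun i : 'I_n => i < N)) /= [X in _ + X]big1 ?addn0.
  exact: big_ord_narrow_cond.
by move=> i /andP[_ /G0].
Qed.

Definition round_bits r :=
  \sum_(i in H) \sum_(j : 'I_n | j != i) msize (hmsg P i (inp i) (take r (hh i)) j).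

Lemma round_bits_small q : q < 6 + R -> ~~ (4 <= q < 4 + R) ->
  round_bits q <= N * (n * (c + c + 1)).
Proof.
move=> qR qn.
apply: (@leq_trans (\sum_(i : 'I_n | i \in H) if i < N then n * (c + c + 1) else 0)).
  apply: leq_sum => i _.
  apply: (@leq_trans (\sum_(j : 'I_n | j != i) if i < N then c + c + 1 else 0)).
    by apply: leq_sum => j _; apply: msg_small.
  rewrite sum_nat_const; case: ifP => _; last by rewrite muln0.
  by apply: leq_mul => //; apply: leq_trans (max_card _) _; rewrite card_ord.
rewrite sum_Q => [|i /negbTE->]; last by [].
apply: (@leq_trans (\sum_(b : 'I_N) n * (c + c + 1))).
  by rewrite big_mkcond; apply: leq_sum => b _; case: (wQ b \in H) => //; case: (wQ b < N).
by rewrite sum_nat_const card_ord.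
Qed.

(** In these rounds only core members send, and only to core members, so exactly the bits of the
    embedded run are counted. *)
Lemma round_bits_ba r : r < R -> round_bits (4 + r) =
  \sum_(i in ba_honest) \sum_(j : 'I_N | j != i)
    msize (hmsg (ba N t) i (ba_input i) (bhist r i) j).
Proof.
move=> rR; have qR : 4 + r < 4 + R by rewrite ltn_add2l.
have silent (i j : 'I_n) : ~~ ((i < N) && (j < N)) ->
    hmsg P i (inp i) (take (4 + r) (hh i)) j = None.
  by move=> out; rewrite hmsg_core // core_sendE ?out //; lia.
rewrite /round_bits sum_Q => [|i iN].
  apply: eq_big => [b|b _]; first by rewrite inE.
  rewrite sum_Q => [|j jN]; last by rewrite silent // negb_and jN orbT.
  apply: eq_big => [j|j _]; first by rewrite (inj_eq wQ_inj).
  by rewrite hmsg_ba // ba_hist // ltnW.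
by rewrite big1 // => j _; rewrite silent // negb_and iN.
Qed.

Lemma bits_sent_le : bits_sent P H inp adv (6 + R) <= 6 * (N * (n * (c + c + 1))) + B.
Proof.
have [_ _ _ baB] := baP ba_input ba_adv card_byz_ba.
have -> : bits_sent P H inp adv (6 + R) = \sum_(0 <= r < 6 + R) round_bits r.
  rewrite big_mkord; apply: eq_bigr => r _; apply: eq_bigr => i _; apply: eq_bigr => j _.
  by rewrite take_hist // ltnW.
set X := N * _.
have small a b : b <= 6 + R -> (forall q, a <= q < b -> ~~ (4 <= q < 4 + R)) ->
    \sum_(a <= r < b) round_bits r <= (b - a) * X.
  move=> bR hq; rewrite -sum_nat_const_nat big_nat_cond [X in _ <= X]big_nat_cond.
  apply: leq_sum => q; rewrite andbT => qab; apply: round_bits_small (hq _ qab).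
  by move: qab; lia.
(* The six rounds outside the agreement are the first four and the last two. *)
rewrite (big_cat_nat _ (n := 4)) //=; rewrite (big_cat_nat _ (m := 4) (n := 4 + R)) /=;
  [|lia|lia].
have h1 : \sum_(0 <= r < 4) round_bits r <= 4 * X.
  by have := small 0 4; rewrite subn0; apply=> [|q]; lia.
have h3 : \sum_(4 + R <= r < 6 + R) round_bits r <= 2 * X.
  by have := small (4 + R) (6 + R); rewrite subnDr; apply=> [|q]; lia.
have h2 : \sum_(4 <= r < 4 + R) round_bits r <= B.
  apply: leq_trans baB; rewrite -{1}(add0n 4) big_addn addKn big_mkord.
  by apply: leq_sum => r _; rewrite addnC round_bits_ba.
by move: h1 h2 h3; lia.
Qed.
End Run.

(** * Asymptotic bounds *)

Lemma n0_le_lin C n t : 0 < n -> n0 C n t <= (C + 3) * t + 1.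
Proof. by rewrite /n0 /smallQ mulnDl; case: ifP; lia. Qed.

(* By minimality of c, (c - 1) k is below l or below (t/5 + 1) log2(n0 + 1),
   and log2(n0 + 1) = O(log t) since n0 = O(t). *)
Lemma codeword_le C n t l : 0 < n -> 0 < l ->
  kpar t * cpar (n0 C n t) t l <=
    (6 * (C + 3) + 25) * maxn l (t * trunc_log 2 t).
Proof.
move=> n1 l0; set D := C + 3; set N := n0 C n t; set lg := trunc_log 2 t.
set M := maxn l _; set k := kpar t.
have lM : l <= M by rewrite leq_maxl.
have tM : t * lg <= M by rewrite leq_maxr.
have lg1 : 1 < t -> 0 < lg by move=> t1; rewrite trunc_log_gt0.
have lg0 : t <= 1 -> lg = 0 by rewrite /lg; case: (t) => [|[|]].
(* For [t <= 4] this is [k = 1 <= l]; beyond that, [t * lg >= t >= k]. *)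
have kM : k <= M.
  rewrite /k /kpar; case: (leqP t 4) => t4; first by rewrite divn_small //; lia.
  by have := lg1 (ltn_trans _ t4) => /(_ isT); nia.
have c0 := cpar_gt0 N t l0.
have := @cpar_min N t l (cpar N t l).-1; rewrite prednK // leqnn => /(_ isT).
set c := cpar N t l in c0 *; rewrite /cpar_ok -/k negb_and -!ltnNge.
case/orP => [h|h].
  apply: (@leq_trans (l + k)); last by nia.
  by move: h; rewrite -{2}(prednK c0); nia.
(* [L] bounds the logarithm of [(D + 2) * (t + 1) >= N + 1]: [D + 2] for the constant factor and
   [lg + 1] for [t + 1]. *)
set L := lg + D + 3.
have NL : N.+1 <= 2 ^ L.
  apply: (@leq_trans (D.+2 * t.+1)); first by have := n0_le_lin C t n1; rewrite -/D -/N; nia.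
  have -> : L = D.+2 + lg.+1 by rewrite /L; lia.
  by rewrite expnD leq_mul // ?trunc_log_ltn // ltnW // ltn_expl.
have : 5 * (c.-1 * k) < L * (t + 5).
  rewrite -(ltn_exp2l _ _ (isT : 1 < 2)); apply: leq_trans h _.
  by rewrite expnM leq_exp2r // addn_gt0 orbT.
move=> {}h; have kc : k * c <= k + L * (t + 5) by move: h; rewrite -{2}(prednK c0); nia.
apply: leq_trans kc _; case: (leqP t 1) => t1.
  by have := lg0 t1; rewrite /L => ->; nia.
have Llg : L <= (D + 4) * lg by have := lg1 t1; rewrite /L; nia.
have : L * (t + 5) <= (D + 4) * lg * (4 * t) by apply: leq_mul => //; lia.
have : (D + 4) * lg * (4 * t) <= (4 * D + 16) * M.
  by rewrite (_ : _ * (4 * t) = (4 * D + 16) * (t * lg)); [rewrite leq_mul2l tM orbT | ring].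
by nia.
Qed.

Theorem theorem1 (ba : forall n t : nat, protocol n bool bool)
    (Rba : nat -> nat -> nat) (C : nat) :
  binary_BA_spec ba Rba ->
  exists K : nat, forall n t l : nat,
    (1 <= n)%N -> (3 * t + 1 <= n)%N -> (1 <= l)%N ->
    forall (H : {set 'I_n}) (inp : 'I_n -> l.-tuple bool) (adv : adversary n),
      (#|~: H| <= t)%N ->
      let P := COOL ba Rba C n t l in
      [/\ (* termination, within O(t) rounds, using O(max(nl, nt log t)) bits *)
          exists Rnd : nat, (Rnd <= K * t.+1)%N /\
            (forall i, i \in H -> exists r o, (r <= Rnd)%N /\ terminates_at P H inp adv i r o) /\
            (bits_sent P H inp adv Rnd <= K * maxn (n * l) (n * t * trunc_log 2 t))%N,
          (* consistency *)
          forall i j r1 r2 o1 o2, i \in H -> j \in H ->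
            terminates_at P H inp adv i r1 o1 -> terminates_at P H inp adv j r2 o2 ->
            o1 = o2
        & (* validity *)
          forall w : l.-tuple bool, (forall i, i \in H -> inp i = w) ->
            forall i r o, i \in H -> terminates_at P H inp adv i r o -> o = Some w ].
Proof.
(* [A] collects six rounds with at most [c + c + 1 <= 3c] bits per message, the factor
   [N <= (5D + 1) k], and the bound [6D + 25] of [codeword_le]. *)
case=> Kb baS; pose D := C + 3; pose A := 18 * (5 * D + 1) * (6 * D + 25).
exists (6 + 2 * Kb + A) => n t l n1 nt l0 H inp adv fH P.
have Nt : 3 * t < n0 C n t by have := n0_ge C nt; lia.
have [RK baP] := baS _ _ Nt.
have [o [term valid]] := agreement nt l0 inp adv fH baP.
split=> [|i j r1 r2 o1 o2 iH jH ti tj|w hw i r o' iH ti].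
- exists (6 + Rba (n0 C n t) t); split; first by nia.
  split=> [i /term[r [rR tr]]|]; first by exists r, o.
  apply: leq_trans (bits_sent_le nt l0 inp adv fH baP) _.
  set N := n0 C n t; set c := cpar N t l; set M := maxn l (t * trunc_log 2 t).
  have -> : maxn (n * l) (n * t * trunc_log 2 t) = n * M by rewrite -mulnA -maxnMr.
  have c0 : 0 < c by apply: cpar_gt0.
  have Nk : N <= (5 * D + 1) * kpar t.
    have := n0_le_lin C t n1; rewrite -/D -/N => h; apply: leq_trans h _.
    have tk : t < 5 * kpar t by rewrite /kpar; lia.
    by nia.
  have Nc : N * c <= (5 * D + 1) * ((6 * D + 25) * M).
    apply: (@leq_trans ((5 * D + 1) * kpar t * c)); first by rewrite leq_mul2r Nk orbT.
    by rewrite -mulnA leq_mul2l codeword_le // orbT.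
  have h1 : 6 * (N * (n * (c + c + 1))) <= A * (n * M).
    apply: (@leq_trans (18 * n * (N * c))); first by nia.
    apply: (@leq_trans (18 * n * ((5 * D + 1) * ((6 * D + 25) * M)))).
      by rewrite leq_mul2l Nc orbT.
    by rewrite /A; apply: eq_leq; ring.
  (* This charges the bits of the binary agreement to [n * M]; for [t <= 1], where the logarithm
     vanishes, [M >= l >= 1] suffices. *)
  have tM : t.+1 <= 2 * M.
    have lM : l <= M by rewrite leq_maxl.
    have tM : t * trunc_log 2 t <= M by rewrite leq_maxr.
    case: (leqP t 1) => t1; first by lia.
    have lg1 : 0 < trunc_log 2 t by rewrite trunc_log_gt0.
    by nia.
  have h2 : Kb * (N * t.+1) <= 2 * Kb * (n * M).
    apply: (@leq_trans (Kb * (n * (2 * M)))); last by apply: eq_leq; ring.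
    by rewrite leq_mul2l leq_mul ?orbT // n0_le.
  by rewrite !mulnDl; apply: leq_trans (leq_add h1 h2) _; lia.
- have [[r [_ tr]] [r' [_ tr']]] := (term i iH, term j jH).
  by rewrite (terminates_at_fun ti tr) (terminates_at_fun tj tr').
have [r' [_ tr]] := term i iH.
by rewrite (terminates_at_fun ti tr) (valid w).
Qed.
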